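(* Let $V\subset\mathbb{R}^d$ be a non-empty, bounded, open set and let $f:\partial V\to\mathbb{R}$ be a continuous function. Then there is at most one solution to the Dirichlet problem for $(V,f)$; that is, there is at most one continuous function $h:\overline{V}\to\mathbb{R}$ such that $h(x)=f(x)$ for all $x\in\partial V$, and such that $h$ has in $V$ continuous partial derivatives of second order satisfying $\Delta h(x)=\sum_{k=1}^d \frac{\partial^2 h(x)}{\partial x_k^2}=0$ for all $x\in V$.
   Context: $\mathbb{R}^d$ carries the Euclidean norm; $\overline{V}$ and $\partial V$ denote the closure and the boundary of $V$. *)

(* Defs.v *)
From HB Require Import structures.
From mathcomp Require Import all_boot all_order all_algebra.
From mathcomp Require Import all_classical all_reals all_analysis.
Set Implicit Arguments.
Unset Strict Implicit.
Unset Printing Implicit Defensive.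
Import Order.TTheory GRing.Theory Num.Theory.
Import numFieldNormedType.Exports.
Local Open Scope classical_set_scope.
Local Open Scope ring_scope.

(* The library norm on 'rV[R]_d is the sup norm. [nbhs_enormP] below shows that
   the topology it carries is the one of the Euclidean norm, so [open],
   [closure], continuity and (partial) derivatives are the Euclidean notions. *)
Definition enorm {R : realType} {d : nat} (x : 'rV[R]_d) : R :=
  Num.sqrt (\sum_(i < d) x ord0 i ^+ 2).

Definition ebounded {R : realType} {d : nat} (V : set 'rV[R]_d) : Prop :=
  exists M : R, forall x, V x -> enorm x <= M.

Definition boundary {T : topologicalType} (V : set T) : set T :=
  closure V `\` interior V.

Definition partial {R : realType} {d : nat} (k : 'I_d) (h : 'rV[R]_d -> R) :
  'rV[R]_d -> R := fun x => 'D_('e_k) h x.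

(* ['D_v h x] is a total [lim], so existence of the derivatives is required
   separately.  For open [V] the conditions only involve the values of [h]
   on [V]. *)
Definition cont_partials2 {R : realType} {d : nat} (V : set 'rV[R]_d)
    (h : 'rV[R]_d -> R) : Prop :=
  forall j k : 'I_d,
    [/\ forall x, V x -> derivable h x 'e_j,
        forall x, V x -> derivable (partial j h) x 'e_k
      & {within V, continuous (partial k (partial j h))}].

Definition laplacian {R : realType} {d : nat} (h : 'rV[R]_d -> R) :
  'rV[R]_d -> R := fun x => \sum_(k < d) partial k (partial k h) x.

(* Functions on the boundary or on the closure of [V] are represented by total
   functions, whose values elsewhere are irrelevant. *)
Definition dirichlet_solution {R : realType} {d : nat} (V : set 'rV[R]_d)
    (f h : 'rV[R]_d -> R) : Prop :=
  [/\ {within closure V, continuous h},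
      forall x, boundary V x -> h x = f x,
      cont_partials2 V h
    & forall x, V x -> laplacian h x = 0].

Lemma le_norm_enorm {R : realType} {d : nat} (x : 'rV[R]_d) : `|x| <= enorm x.
Proof.
rewrite /Num.norm /= mx_normrE.
apply: bigmax_le => [|[i j] _ /=]; first exact: sqrtr_ge0.
rewrite ord1 -sqrtr_sqr ler_wsqrtr// (bigD1 j)//= lerDl.
by apply: sumr_ge0 => k _; exact: sqr_ge0.
Qed.

Lemma le_enorm_norm {R : realType} {d : nat} (x : 'rV[R]_d) :
  enorm x <= Num.sqrt d%:R * `|x|.
Proof.
rewrite -[X in _ * X]ger0_norm// -sqrtr_sqr -sqrtrM// ler_wsqrtr//.
rewrite mulr_natl -[X in _ *+ X]card_ord -sumr_const ler_sum// => i _.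
rewrite -real_normK ?num_real// ler_pXn2r ?nnegrE//.
rewrite {2}/Num.norm /= mx_normrE.
exact: (le_bigmax _ (fun ij => `|x ij.1 ij.2|) (ord0, i)).
Qed.

Lemma nbhs_enormP {R : realType} {d : nat} (x : 'rV[R]_d) (A : set 'rV[R]_d) :
  nbhs x A <-> exists2 e : R, 0 < e & forall y, enorm (y - x) < e -> A y.
Proof.
split=> [/nbhs_ballP[e /= e0 xeA]|[e e0 xeA]].
  exists e => // y yx; apply: xeA; rewrite -ball_normE /=.
  by rewrite distrC (le_lt_trans (le_norm_enorm _)).
have c0 : 0 < Num.sqrt d%:R + 1 :> R by rewrite ltr_wpDl// sqrtr_ge0.
apply/nbhs_ballP; exists (e / (Num.sqrt d%:R + 1)); first exact: divr_gt0.
move=> y; rewrite -ball_normE /= distrC ltr_pdivlMr// mulrC => yx.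
apply: xeA; apply: le_lt_trans yx; apply: le_trans (le_enorm_norm _) _.
by rewrite ler_wpM2r// lerDl.
Qed.

(* Main.v *)
Require Import Defs.
From mathcomp Require Import all_boot all_order all_algebra.
From mathcomp Require Import all_classical all_reals all_analysis.
From mathcomp Require Import ring lra.
Import Order.TTheory GRing.Theory Num.Theory.
Import numFieldNormedType.Exports.
Local Open Scope classical_set_scope.
Local Open Scope ring_scope.

(* For e > 0 the function w y = h1 y - h2 y + e y_0^2 has Laplacian 2 e > 0
   in V.  At an interior maximum all the second partial derivatives would be
   nonpositive, so w attains its maximum over the compact closure of V on the
   boundary, where h1 = h2.  Hence h1 - h2 <= e M^2 with M a bound on V; let e
   tend to 0, and exchange h1 and h2. *)

(** Fermat's rule gives [dg x = 0]. If [c] were positive, [dg] would be positive just to the right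
    of [x], and the mean value theorem would push [g] above [g x] there. *)
Lemma derive2_at_max (R : realType) (g dg : R -> R) (x c : R) :
  (\forall t \near x, is_derive (t : R) (1 : R) g (dg t)) ->
  is_derive x (1 : R) dg c ->
  (\forall t \near x, g t <= g x) -> c <= 0.
Proof.
move=> g' [dgx dgxc] gmax; rewrite leNgt; apply/negP => c0.
have [e /= e0 He] :
    \forall t \near x, is_derive (t : R) (1 : R) g (dg t) /\ g t <= g x.
  by near=> t; split; near: t.
have {}He t :
    x - e < t < x + e -> is_derive (t : R) (1 : R) g (dg t) /\ g t <= g x.
  by move=> ?; apply: He; rewrite /ball/= ltr_distlC.
have xI : x - e < x < x + e by lra.
have dgx0 : dg x = 0.
  have [gx <-] := (He _ xI).1.
  apply/derive_val/(@derive1_at_max _ _ (x - e) (x + e)) => [|t||t].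
  - lra.
  - by rewrite in_itv => /He[[]].
  - by rewrite in_itv.
  - by rewrite in_itv => /He[].
(* The difference quotients of [dg] at [x] tend to [c > 0], so they are positive within some radius
   [r]. *)
have [r /= r0 Hr] : \forall h \near 0^', 0 < h^-1 *: (dg (h *: 1 + x) - dg x).
  have : h^-1 *: (dg (h *: 1 + x) - dg x) @[h --> 0^'] --> c.
    by rewrite -dgxc; exact: dgx.
  by move/cvgr_gt; exact.
(* Halving keeps [x + s] strictly inside both neighbourhoods. *)
pose s := Num.min e r / 2.
have [s0 se sr] : [/\ 0 < s, s < e & s < r].
  have : 0 < Num.min e r by rewrite lt_min e0.
  have : Num.min e r <= e by rewrite ge_min lexx.
  have : Num.min e r <= r by rewrite ge_min lexx orbT.
  by rewrite /s; split; lra.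
have [|||xi] := @MVT _ g dg x (x + s).
- lra.
- by move=> t; rewrite in_itv/= => ?; apply: (He _ _).1; lra.
- apply: derivable_within_continuous => t; rewrite in_itv/= => ?.
  by have [[]] : is_derive t (1 : R) g (dg t) /\ g t <= g x
    by apply: He; lra.
rewrite in_itv/= => /andP[xxi xis] gxs.
have : 0 < (xi - x)^-1 *: (dg ((xi - x) *: 1 + x) - dg x).
  apply: Hr => /=; last by lra.
  by rewrite sub0r normrN ger0_norm; lra.
rewrite dgx0 subr0 /GRing.scale/= mulr1 subrK pmulr_rgt0 ?invr_gt0 ?subr_gt0//.
move=> dgxi; have : 0 < dg xi * (x + s - x) by rewrite mulr_gt0//; lra.
have [_] : is_derive (x + s) (1 : R) g (dg (x + s)) /\ g (x + s) <= g x
  by apply: He; lra.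
lra.
Unshelve. all: by end_near. Qed.

(** Both derivatives are limits of the same difference quotients; this reduces partial derivatives
    to one-variable calculus. *)
Lemma is_derive_line (R : realType) (V W : normedModType R) (h : V -> W)
    (x v : V) (t : R) :
  derivable h (x + t *: v) v ->
  is_derive t (1 : R) (fun s => h (x + s *: v)) ('D_v h (x + t *: v)).
Proof.
have E : (fun r => r^-1 *: (h (x + (r *: 1 + t) *: v) - h (x + t *: v))) =
         (fun r => r^-1 *: ((h \o shift (x + t *: v)) (r *: v) - h (x + t *: v))).
  apply/funext => r /=; congr (_ *: (h _ - _)).
  by rewrite scalerDl /GRing.scale/= mulr1 addrCA.
by move=> hd; split; rewrite /derivable /derive /= E.
Qed.

Lemma near_line (R : realType) (V : normedModType R) (A : set V) (x v : V) :
  nbhs x A -> \forall t \near (0 : R), A (x + t *: v).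
Proof.
move=> Ax; have : x + t *: v @[t --> (0 : R)] --> x.
  rewrite -[X in _ --> X]addr0 -[X in _ --> _ + X](scale0r v).
  by apply: cvgD; [exact: cvg_cst|apply: cvgZr_tmp; exact: cvg_id].
exact.
Qed.

Lemma is_derive_affine (R : realType) (a b c t : R) :
  is_derive t (1 : R) (fun s => c * (a + s * b)) (c * b).
Proof.
have -> : (fun s => c * (a + s * b)) = cst (c * a) + (c * b) \*: id.
  by apply/funext => s; transitivity (c * a + c * b * s); first ring.
by apply: is_derive_eq; rewrite add0r /GRing.scale/= mulr1.
Qed.

Lemma is_derive_affine_sqr (R : realType) (a b c t : R) :
  is_derive t (1 : R) (fun s => c * (a + s * b) ^+ 2)
    (2 * c * b * (a + t * b)).
Proof.
have -> : (fun s => c * (a + s * b) ^+ 2) =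
          (fun s => c * (a + s * b)) * (fun s => 1 * (a + s * b)).
  by apply/funext => s; rewrite !fctE; ring.
have := is_deriveM (is_derive_affine _ a b c t) (is_derive_affine _ a b 1 t).
by move/is_derive_eq; apply; rewrite /GRing.scale/=; ring.
Qed.

(** The inequality holds summand by summand: the restriction to the line through [x] along ['e_k]
    has a local maximum at 0, so its second derivative there is nonpositive. *)
Lemma laplacian_le_at_max (R : realType) (d : nat) (V : set 'rV[R]_d)
    (h1 h2 : 'rV[R]_d -> R) (i : 'I_d) (e : R) (x : 'rV[R]_d) :
  open V -> cont_partials2 V h1 -> cont_partials2 V h2 -> V x ->
  (forall y, V y -> h1 y - h2 y + e * y ord0 i ^+ 2 <=
                    h1 x - h2 x + e * x ord0 i ^+ 2) ->
  laplacian h1 x - laplacian h2 x + 2 * e <= 0.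
Proof.
move=> Vo C1 C2 Vx xmax.
(* The [k]-th term is the second derivative along ['e_k] of [e] times the square of coordinate
   [i]. *)
have -> : 2 * e = \sum_(k < d) 2 * e * (k == i)%:R ^+ 2.
  rewrite (bigD1 i)//= eqxx big1 ?addr0 ?expr1n ?mulr1// => k /negPf ->.
  by rewrite expr0n mulr0.
rewrite -sumrB -big_split/=; apply: sumr_le0 => k _.
have [D1 D11 _] := C1 k k; have [D2 D22 _] := C2 k k.
pose b : R := (k == i)%:R.
pose l t := x + t *: ('e_k : 'rV[R]_d).
have lE t : l t ord0 i = x ord0 i + t * b.
  by rewrite !mxE eqxx/= eq_sym.
have Vl : \forall t \near (0 : R), V (l t).
  by apply: near_line; exact: open_nbhs_nbhs.
have l0 : l 0 = x by rewrite /l scale0r addr0.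
have line0 (h : 'rV[R]_d -> R) : derivable h x 'e_k ->
    is_derive (0 : R) (1 : R) (h \o l) (partial k h x).
  by have := @is_derive_line _ _ _ h x 'e_k 0; rewrite scale0r addr0.
apply: (@derive2_at_max _
  (fun t => h1 (l t) - h2 (l t) + e * (x ord0 i + t * b) ^+ 2)
  (fun t => partial k h1 (l t) - partial k h2 (l t)
            + 2 * e * b * (x ord0 i + t * b)) 0).
- near=> t.
  have Vt : V (l t) by near: t.
  apply: is_deriveD; last exact: is_derive_affine_sqr.
  by apply: is_deriveB; apply: is_derive_line; [exact: D1|exact: D2].
- rewrite expr2 [X in _ + X]mulrA; apply: is_deriveD.
    by apply: is_deriveB; apply: line0; [exact: D11|exact: D22].
  exact: is_derive_affine.
- near=> t.
  have Vt : V (l t) by near: t.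
  have := xmax _ Vt.
  by rewrite lE l0 mul0r addr0.
Unshelve. all: by end_near. Qed.

Lemma dirichlet_solution_le (R : realType) (d : nat) (hd : (0 < d)%N)
    (V : set 'rV[R]_d) (f h1 h2 : 'rV[R]_d -> R) :
  ebounded V -> open V ->
  dirichlet_solution V f h1 -> dirichlet_solution V f h2 ->
  forall x, closure V x -> h1 x <= h2 x.
Proof.
move=> [M VM] Vo [h1c h1f C1 L1] [h2c h2f C2 L2] x Vx.
(* Positivity of [d] supplies the coordinate whose square perturbs [h1 - h2]. *)
pose i := Ordinal hd.
have clM y : closure V y -> `|y| <= M.
  have cM : closed [set y : 'rV[R]_d | `|y| <= M].
    apply: (@preimage_closed _ _ (fun y : 'rV[R]_d => `|y|) [set r | r <= M]).
      by move=> ? _; exact: norm_continuous.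
    exact: closed_le.
  move=> Vy; apply: cM; apply: closureS Vy => z Vz /=.
  exact: le_trans (le_norm_enorm z) (VM z Vz).
have Vcpt : compact (closure V).
  apply: bounded_closed_compact; last exact: closed_closure.
  exists M; split; first exact: num_real.
  by move=> r Mr y /clM yM; exact: le_trans yM (ltW Mr).
suff le_e (e : R) : 0 < e -> h1 x - h2 x <= e * M ^+ 2.
  rewrite -subr_le0 leNgt; apply/negP => u0.
  have M0 : 0 < M ^+ 2 + 1 by rewrite ltr_wpDl ?sqr_ge0.
  (* With [u = h1 x - h2 x > 0] and [e = u / (M ^+ 2 + 1)], the bound would read
     [u * (M ^+ 2 + 1) <= u * M ^+ 2]. *)
  have := le_e _ (divr_gt0 u0 M0).
  rewrite mulrAC ler_pdivlMr// ler_pM2l//; lra.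
move=> e0.
pose w y := h1 y - h2 y + e * y ord0 i ^+ 2.
have wc : {within closure V, continuous w}.
  apply: within_continuousD; first exact: within_continuousB.
  apply: continuous_subspaceT.
  have sqr_cont : continuous (fun y : 'rV[R]_d => y ord0 i ^+ 2).
    move=> y; apply: continuous_comp (@exprn_continuous _ 2 _).
    exact: coord_continuous.
  by move=> y; exact: continuousM (@cst_continuous _ _ e y) (sqr_cont y).
have [|y + ymax] := @EVT_max_rV _ _ w _ _ Vcpt wc; first by exists x.
rewrite inE => Vy.
have {}ymax z : closure V z -> w z <= w y by move=> Vz; apply: ymax; rewrite inE.
have [yV|yNV] := pselect (V y).
  (* An interior maximum is impossible: both Laplacians vanish at [y], which leaves [2 * e <= 0]. *)
  have Vmax z : V z -> w z <= w y by move=> Vz; exact/ymax/subset_closure.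
  have := @laplacian_le_at_max _ _ _ _ _ i e _ Vo C1 C2 yV Vmax.
  by rewrite L1// L2// subrr add0r leNgt mulr_gt0.
have yb : boundary V y by split=> //; move/interior_subset.
(* Chain: [h1 x - h2 x <= w x <= w y], where [w y] reduces to [e * y ord0 i ^+ 2] on the boundary,
   and a coordinate is bounded by the sup norm, hence by [M]. *)
apply: (@le_trans _ _ (w x)); first by rewrite lerDl mulr_ge0 ?sqr_ge0// ltW.
apply: (le_trans (ymax _ Vx)).
rewrite /w h1f// h2f// subrr add0r ler_pM2l//.
rewrite -real_normK ?num_real// ler_pXn2r ?nnegrE//.
  apply: le_trans (clM _ Vy); rewrite {2}/Num.norm /= mx_normrE.
  exact: (le_bigmax _ (fun ij => `|y ij.1 ij.2|) (ord0, i)).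
exact: le_trans (clM _ Vy).
Qed.

Theorem theorem2p5 (R : realType) (d : nat) (hd : (0 < d)%N)
    (V : set 'rV[R]_d) (V_nonempty : V !=set0) (V_bounded : ebounded V)
    (V_open : open V) (f : 'rV[R]_d -> R)
    (f_cont : {within boundary V, continuous f}) (h1 h2 : 'rV[R]_d -> R) :
  dirichlet_solution V f h1 -> dirichlet_solution V f h2 ->
  forall x, closure V x -> h1 x = h2 x.
Proof.
move=> s1 s2 x Vx; apply/le_anti/andP.
by split; apply: (dirichlet_solution_le _ _ hd _ _ _ _ V_bounded V_open) Vx;
  eassumption.
Qed.
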